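(* Let $f:\mathbb{R}^n\to\mathbb{R}^n$ and $h:\mathbb{R}^n\to\mathbb{R}^p$ define the autonomous system $\dot x=f(x)$, $y=h(x)$, with solution $\varphi(t,0,x_0)$ starting from $x_0$ at $t=0$, and let $\Omega\subset\mathbb{R}^n$ be a compact set of permissible initial conditions, subject to the standing assumptions in the context (in particular, solutions starting in $\Omega$ are defined on $[0,\tau)$, $0<\tau\le\infty$). If the system is D-observable with respect to $\Omega$ and R-observable with respect to $\Omega$, then there is a finite $T$ with $0<T<\tau$ such that for all $x_1,x_2\in\Omega$ with $x_1\neq x_2$ there exists $t$ with $0\le t\le T$ and $h(\varphi(t,0,x_1))\neq h(\varphi(t,0,x_2))$.
   Context: Setting and standing assumptions. Consider $\dot x=f(x)$, $y=h(x)$ with state $x\in\mathbb{R}^n$ and output $y\in\mathbb{R}^p$. The functions $f$ and $h$ are continuous and smooth up to the required order: for the integer $N\ge 1$ occurring in the definition of R-observability below, $h$ is $N$ times and $f$ is $N-1$ times continuously differentiable. The set $\Omega\subset\mathbb{R}^n$ of permissible initial conditions is compact (the state space $\mathbb{R}^n$ is not). For $x_0\in\Omega$ the solution with initial value $x_0$ at $t=0$ is unique and is denoted by $\varphi(t,0,x_0)$; it is a continuous function of $x_0$. Solutions are well defined on the time interval considered: there is $\tau\in(0,\infty]$ such that for every $x_0\in\Omega$ the solution $\varphi(t,0,x_0)$ is defined for all $t\in[0,\tau)$ (the forward complete case is $\tau=\infty$). Indistinguishable pair: a pair $(x_1,x_2)$ of initial states with $x_1\ne x_2$ such that $h(\varphi(t,0,x_1))=h(\varphi(t,0,x_2))$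 for all $t\in[0,\tau)$ (i.e. for all $t\ge 0$ when $\tau=\infty$). D-observability with respect to $\Omega$: there is no indistinguishable pair $(x_1,x_2)$ with $x_1,x_2\in\Omega$. R-observability with respect to $\Omega$: there exists an integer $N>0$ such that the Jacobian of the map $H(x)=(h(x),L_fh(x),\ldots,L_f^{N-1}h(x))\in\mathbb{R}^{Np}$ has full rank, i.e. rank $n$, at every point $x\in\Omega$, where $L_fh=\frac{\partial h}{\partial x}f$ and $L_f^kh=L_f(L_f^{k-1}h)$. *)

(* Defs.v *)
(* MathComp-Analysis; states and outputs are row vectors over R : realType. *)
From HB Require Import structures.
From mathcomp Require Import all_boot all_order all_algebra.
From mathcomp Require Import all_classical all_reals all_analysis.
Set Implicit Arguments.
Unset Strict Implicit.
Unset Printing Implicit Defensive.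
Import Order.TTheory GRing.Theory Num.Theory.
Import numFieldNormedType.Exports.
Local Open Scope classical_set_scope.
Local Open Scope ring_scope.

(* The time interval [0, tau[, where tau may be +oo. *)
Definition horizon (R : realType) (tau : \bar R) : set R :=
  [set t | 0 <= t /\ (t%:E < tau)%E].

(* z' = f(z) on [0, tau[. The derivative is relative to the interval, hence
   one-sided at 0; the values of z outside [0, tau[ are irrelevant. *)
Definition solves (R : realType) (n : nat) (f : 'rV[R]_n -> 'rV[R]_n)
    (tau : \bar R) (z : R -> 'rV[R]_n) : Prop :=
  forall t : R, horizon tau t ->
    (s - t)^-1 *: (z s - z t) @[s --> within (horizon tau) t^'] --> f (z t).

(* phi t x0 stands for phi(t, 0, x0): a solution on all of [0, tau[ for every
   x0 in Omega, with which any other solution through x0, on an interval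
   [0, sigma[ that may be shorter, agrees. *)
Definition solution_map (R : realType) (n : nat) (f : 'rV[R]_n -> 'rV[R]_n)
    (Omega : set 'rV[R]_n) (tau : \bar R) (phi : R -> 'rV[R]_n -> 'rV[R]_n) :
    Prop :=
  forall x0, Omega x0 ->
    [/\ phi 0 x0 = x0,
        solves f tau (phi ^~ x0) &
        forall (sigma : \bar R) (z : R -> 'rV[R]_n),
          (0 < sigma)%E -> (sigma <= tau)%E -> z 0 = x0 -> solves f sigma z ->
          forall t, horizon sigma t -> z t = phi t x0].

Definition indistinguishable (R : realType) (n p : nat)
    (h : 'rV[R]_n -> 'rV[R]_p) (tau : \bar R)
    (phi : R -> 'rV[R]_n -> 'rV[R]_n) (x1 x2 : 'rV[R]_n) : Prop :=
  x1 <> x2 /\ forall t, horizon tau t -> h (phi t x1) = h (phi t x2).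

Definition D_observable (R : realType) (n p : nat)
    (h : 'rV[R]_n -> 'rV[R]_p) (Omega : set 'rV[R]_n) (tau : \bar R)
    (phi : R -> 'rV[R]_n -> 'rV[R]_n) : Prop :=
  ~ exists x1 x2 : 'rV[R]_n,
      [/\ Omega x1, Omega x2 & indistinguishable h tau phi x1 x2].

(* Class C^k on R^n. Differentiability makes v |-> 'D_v g x linear, so asking
   that every directional derivative be of class C^k says that dg is C^k. *)
Fixpoint Ck (R : realType) (n m k : nat) (g : 'rV[R]_n -> 'rV[R]_m) : Prop :=
  if k is k'.+1 then
    (forall x, differentiable g x) /\
    (forall v : 'rV[R]_n, Ck k' (fun x => 'D_v g x))
  else continuous g.

(* With row vectors, 'J h x is the transpose of dh/dx, so (dh/dx) f reads
   f x *m 'J h x. *)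
Definition lie (R : realType) (n p : nat) (f : 'rV[R]_n -> 'rV[R]_n)
    (h : 'rV[R]_n -> 'rV[R]_p) : 'rV[R]_n -> 'rV[R]_p :=
  fun x => f x *m 'J h x.

(* H(x) = (h(x), L_f h(x), ..., L_f^(N-1) h(x)), the N blocks of length p being
   concatenated into one vector of length N * p. *)
Definition obs_map (R : realType) (n p : nat) (f : 'rV[R]_n -> 'rV[R]_n)
    (h : 'rV[R]_n -> 'rV[R]_p) (N : nat) : 'rV[R]_n -> 'rV[R]_(N * p) :=
  fun x => mxvec (\matrix_(k < N, j < p) iter k (lie f) h x 0 j).

(* The smoothness requirement refers to the same N as the rank condition: it
   makes the iterated Lie derivatives and the Jacobian of H exist. *)
Definition R_observable (R : realType) (n p : nat) (f : 'rV[R]_n -> 'rV[R]_n)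
    (h : 'rV[R]_n -> 'rV[R]_p) (Omega : set 'rV[R]_n) : Prop :=
  exists N : nat,
    [/\ (0 < N)%N, Ck N h, Ck N.-1 f &
        forall x, Omega x -> \rank ('J (obs_map f h N) x) = n].

(* Main.v *)
Require Import Defs.
From HB Require Import structures.
From mathcomp Require Import all_boot all_order all_algebra.
From mathcomp Require Import all_classical all_reals all_analysis.
From mathcomp Require Import ring.
Set Implicit Arguments.
Unset Strict Implicit.
Unset Printing Implicit Defensive.
Import Order.TTheory GRing.Theory Num.Theory.
Import numFieldNormedType.Exports.
Local Open Scope classical_set_scope.
Local Open Scope ring_scope.

(** The proof is a compactness argument. If no finite time [T < tau]
    distinguished all pairs of distinct points of [Omega], the sets [A T] of
    distinct pairs with the same output on [[0, T]] would all be nonempty; they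
    decrease with [T], so they generate a proper filter on the compact set
    [Omega `*` Omega], which has a cluster point [(a, b)].

    If [a <> b], D-observability gives a time [t < tau] at which the outputs of
    [a] and [b] differ. By continuity of [h \o phi t] they still differ for all
    pairs near [(a, b)] ([within_separated]), whereas every neighbourhood of
    [(a, b)] meets [A T] for some [T >= t].

    If [a = b], R-observability takes over. Equality of the outputs on a
    nontrivial interval [[0, T[] propagates to all their derivatives, which
    along a solution are the iterated Lie derivatives of [h] ([lie_output_eq]).
    At time [0] this says that the observability map [H] takes the same value at
    both points of a pair of [A T]. But [H] is of class C^1 ([Ck_obs_map]) with
    injective differential at [a], hence injective on a ball around [a]
    ([locally_injective]), and this ball contains both points of some pair of
    [A T], which are distinct. *)

(** * Functions of class C^k *)

Lemma derive_coord (R : realType) (n m : nat) (g : 'rV[R]_n -> 'rV[R]_m)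
    (x v : 'rV[R]_n) (j : 'I_m) :
  differentiable g x -> 'D_v (fun y => g y 0 j) x = ('D_v g x) 0 j.
Proof.
by move=> gx; rewrite (derive_mx (diff_derivable gx)) mxE.
Qed.

Lemma differentiable_coord_comp (R : realType) (n m : nat)
    (g : 'rV[R]_n -> 'rV[R]_m) (x : 'rV[R]_n) (j : 'I_m) :
  differentiable g x -> differentiable (fun y => g y 0 j) x.
Proof.
move=> gx.
apply: (@differentiable_comp _ _ _ _ g (fun N : 'rV_m => N 0 j)) => //.
exact: differentiable_coord.
Qed.

Lemma continuous_coord_comp (R : realType) (n m : nat)
    (g : 'rV[R]_n -> 'rV[R]_m) (j : 'I_m) :
  continuous g -> continuous (fun y => g y 0 j).
Proof.
move=> gc x; have := @cvg_comp _ _ _ g (fun N : 'rV_m => N 0 j) _ _ _ (gc x).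
apply; exact: coord_continuous.
Qed.

Lemma CkS (R : realType) (n m k : nat) (g : 'rV[R]_n -> 'rV[R]_m) :
  Ck k.+1 g -> Ck k g.
Proof.
elim: k g => [g [dg _] x|k IHk g [dg Cg]].
  exact: differentiable_continuous.
by split=> // v; apply/IHk/Cg.
Qed.

Lemma Ck_le (R : realType) (n m k l : nat) (g : 'rV[R]_n -> 'rV[R]_m) :
  (k <= l)%N -> Ck l g -> Ck k g.
Proof.
move=> /subnKC <-; elim: (l - k)%N => [|d IHd]; first by rewrite addn0.
by rewrite addnS => /CkS.
Qed.

Lemma Ck_cst (R : realType) (n m k : nat) (c : 'rV[R]_m) :
  Ck k (cst c : 'rV[R]_n -> 'rV[R]_m).
Proof.
elim: k c => [c|k IHk c]; first exact: cst_continuous.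
split=> [//|v]; rewrite (_ : (fun x => _) = cst 0) //.
by apply/funext=> x; rewrite derive_cst.
Qed.

Lemma CkD (R : realType) (n m k : nat) (f g : 'rV[R]_n -> 'rV[R]_m) :
  Ck k f -> Ck k g -> Ck k (f \+ g).
Proof.
elim: k f g => [f g fc gc x|k IHk f g [df Cf] [dg Cg]].
  by apply: continuousD; [exact: fc|exact: gc].
split=> [x|v]; first exact: differentiableD.
rewrite (_ : (fun x => _) = (fun x => 'D_v f x) \+ (fun x => 'D_v g x)).
  by apply: IHk; [exact: Cf|exact: Cg].
by apply/funext=> x; rewrite deriveD//; apply: diff_derivable.
Qed.

Lemma Ck_sum (R : realType) (n m k : nat) (I : Type) (s : seq I)
    (f : I -> 'rV[R]_n -> 'rV[R]_m) :
  (forall i, Ck k (f i)) -> Ck k (fun x => \sum_(i <- s) f i x).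
Proof.
move=> Cf; elim: s => [|i s IHs].
  rewrite (_ : (fun x => _) = cst 0); first exact: Ck_cst.
  by apply/funext=> x; rewrite big_nil.
rewrite (_ : (fun x => _) = f i \+ (fun x => \sum_(i <- s) f i x)).
  apply: CkD; [exact: Cf|exact: IHs].
by apply/funext=> x; rewrite big_cons.
Qed.

(** Leibniz rule: the directional derivatives are sums of two functions of the
    same shape, with [f] or [g] replaced by its derivative. Multiplying a fixed
    vector [w] keeps the values vectors, where [Ck] lives, although the
    calculus is that of scalar functions. *)
Lemma Ck_coordM (R : realType) (n a b m k : nat) (f : 'rV[R]_n -> 'rV[R]_a)
    (g : 'rV[R]_n -> 'rV[R]_b) (i : 'I_a) (j : 'I_b) (w : 'rV[R]_m) :
  Ck k f -> Ck k g -> Ck k (fun x => (f x 0 i * g x 0 j) *: w).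
Proof.
elim: k f g => [f g fc gc x|k IHk f g Cf Cg].
  have fi := @continuous_coord_comp _ _ _ f i fc.
  have gj := @continuous_coord_comp _ _ _ g j gc.
  have fgc := cvgM (fi x) (gj x).
  exact: cvgZr_tmp (fgc _).
have [[df Cdf] [dg Cdg]] := (Cf, Cg).
have dfi x := differentiable_coord_comp i (df x).
have dgj x := differentiable_coord_comp j (dg x).
have dfg x := differentiableM (dfi x) (dgj x).
split=> [x|v]; first exact: differentiableZl (dfg x).
rewrite (_ : (fun x => _) =
  (fun x => ('D_v f x 0 i * g x 0 j) *: w) \+
  (fun x => (f x 0 i * 'D_v g x 0 j) *: w)).
  apply: CkD.
    by apply: IHk; [exact: Cdf|exact: CkS].
  by apply: IHk; [exact: CkS|exact: Cdg].
apply/funext=> x; rewrite deriveE; last exact: differentiableZl (dfg x).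
rewrite (diffZl w (dfg x)) -deriveE// deriveM; try exact: diff_derivable.
rewrite /= -scalerDl !derive_coord// addrC.
by congr ((_ + _) *: w); rewrite [LHS]mulrC.
Qed.

Lemma Ck_coord (R : realType) (n a m k : nat) (f : 'rV[R]_n -> 'rV[R]_a)
    (i : 'I_a) (w : 'rV[R]_m) :
  Ck k f -> Ck k (fun x => f x 0 i *: w).
Proof.
move=> Cf; rewrite (_ : (fun x => _) =
  (fun x => (f x 0 i * (cst (const_mx 1) : _ -> 'rV_1) x 0 0) *: w)).
  by apply: Ck_coordM => //; exact: Ck_cst.
by apply/funext=> x; rewrite mxE mulr1.
Qed.

Lemma lieE (R : realType) (n p : nat) (f : 'rV[R]_n -> 'rV[R]_n)
    (g : 'rV[R]_n -> 'rV[R]_p) (x : 'rV[R]_n) :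
  differentiable g x -> lie f g x = 'd g x (f x).
Proof. by move=> gx; rewrite -deriveE// deriveEjacobian. Qed.

(** In coordinates, [L_f g] is a sum of products of a coordinate of [f] and a
    coordinate of a partial derivative of [g]. *)
Lemma Ck_lie (R : realType) (n p k : nat) (f : 'rV[R]_n -> 'rV[R]_n)
    (g : 'rV[R]_n -> 'rV[R]_p) :
  Ck k f -> Ck k.+1 g -> Ck k (lie f g).
Proof.
move=> Cf [dg Cg].
rewrite (_ : lie f g = fun x => \sum_(i < n) \sum_(j < p)
  (f x 0 i * ('D_(delta_mx 0 i) g x) 0 j) *: delta_mx 0 j).
  by do 2![apply: Ck_sum => ?]; apply: Ck_coordM; [exact: Cf|exact: Cg].
apply/funext=> x; rewrite lieE// {1}[f x]row_sum_delta linear_sum.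
apply: eq_bigr => i _; rewrite linearZ/= -deriveE//.
rewrite [in LHS](row_sum_delta ('D__ _ _)).
rewrite scaler_sumr; apply: eq_bigr => j _; exact: scalerA.
Qed.

(** Each Lie derivative costs one derivative of [h], and [L_f^k h] involves the
    derivatives of [f] only up to order [k - 1] when [0 < k]. *)
Lemma Ck_iter_lie (R : realType) (n p N k : nat) (f : 'rV[R]_n -> 'rV[R]_n)
    (h : 'rV[R]_n -> 'rV[R]_p) :
  Ck N.-1 f -> Ck N h -> (k < N)%N -> Ck (N - k) (iter k (lie f) h).
Proof.
move=> Cf Ch; elim: k => [|k IHk] kN; first by rewrite subn0.
apply: Ck_lie.
  by apply: Ck_le Cf; rewrite subnS -!subn1 leq_sub2r ?leq_subr.
by rewrite subnSK ?(ltnW kN)//; apply/IHk/ltnW.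
Qed.

Lemma Ck_obs_map (R : realType) (n p N : nat) (f : 'rV[R]_n -> 'rV[R]_n)
    (h : 'rV[R]_n -> 'rV[R]_p) :
  Ck N.-1 f -> Ck N h -> Ck 1 (obs_map f h N).
Proof.
move=> Cf Ch; rewrite (_ : obs_map f h N = fun x => \sum_(k < N) \sum_(j < p)
  iter k (lie f) h x 0 j *: mxvec (delta_mx k j)).
  apply: Ck_sum => k; apply: Ck_sum => j; apply: Ck_coord.
  apply: (@Ck_le _ _ _ 1 (N - k)%N); first by rewrite subn_gt0.
  exact: Ck_iter_lie.
apply/funext=> x; rewrite /obs_map [X in mxvec X]matrix_sum_delta linear_sum.
apply: eq_bigr => k _; rewrite linear_sum; apply: eq_bigr => j _.
by rewrite linearZ/= mxE.
Qed.

(** * Outputs along solutions *)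

(** Chain rule for a derivative relative to a subset of the line, which the
    filter [F] stands for: the one-sided derivative at the initial time and the
    two-sided one at later times are both instances. *)
Lemma cvg_chain (R : realType) (V W : normedModType R) (F : set_system R)
    (FF : Filter F) (t : R) (z : R -> V) (w : V) (g : V -> W) :
  F `=>` t^' -> differentiable g (z t) ->
  (s - t)^-1 *: (z s - z t) @[s --> F] --> w ->
  (s - t)^-1 *: (g (z s) - g (z t)) @[s --> F] --> 'd g (z t) w.
Proof.
move=> Ft dg zw.
have Fneq : \forall s \near F, s != t.
  exact/Ft/(nbhs_dnbhs_neq t).
have st0 : (s - t) @[s --> F] --> 0.
  rewrite -(subrr t); apply: cvgB; last exact: cvg_cst.
  by move=> A /nbhs_dnbhs /Ft.
have z0 : (z s - z t) @[s --> F] --> 0.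
  rewrite -(scale0r w); apply: cvg_trans (cvgZ st0 zw).
  apply: near_eq_cvg; near=> s.
  by rewrite scalerA mulfV ?scale1r// subr_eq0; near: s.
have [M M0 zM] : exists2 M, 0 < M &
    \forall s \near F, `|(s - t)^-1 *: (z s - z t)| <= M.
  exists (`|w| + 1); first by rewrite ltr_wpDl.
  move/cvgrPdist_le : zw => /(_ 1 ltr01); apply: filterS => s ws.
  rewrite -lerBlDl; apply: le_trans ws; rewrite distrC.
  exact: lerB_dist.
have dgw : 'd g (z t) ((s - t)^-1 *: (z s - z t)) @[s --> F] --> 'd g (z t) w.
  by apply: continuous_cvg zw; apply: diff_continuous.
(* The increment [z s - z t] is [O(s - t)], so the remainder of the expansion
   of [g] at [z t], being [o(z s - z t)], is [o(s - t)]. *)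
have /eqaddoP rem := diff_locally dg.
apply/cvgrPdist_le => e e0.
have e20 : 0 < e / 2 by rewrite divr_gt0.
move/cvgrPdist_le : dgw => /(_ _ e20) dgw.
have eM0 : 0 < e / 2 / M by rewrite divr_gt0.
have {}rem := z0 _ (rem _ eM0).
near=> s.
rewrite -(subrKA ('d g (z t) ((s - t)^-1 *: (z s - z t)))) [e]splitr.
apply: (le_trans (ler_normD _ _)); apply: lerD; first by near: s.
have : `|g (z s) - (g (z t) + 'd g (z t) (z s - z t))| <=
    e / 2 / M * `|z s - z t|.
  suff : (fun v => `|(g \o shift (z t) - (cst (g (z t)) + 'd g (z t))) v| <=
      e / 2 / M * `|id v|) (z s - z t).
    by rewrite /= !fctE /= subrK.
  by near: s.
rewrite [X in X <= _]distrC => /(ler_wpM2l (normr_ge0 (s - t)^-1)) H.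
rewrite linearZ/= -scalerBr normrZ opprB addrCA addrA; apply: (le_trans H).
rewrite mulrCA -normrZ mulrAC ler_pdivrMr// ler_wpM2l//; first exact: ltW.
by near: s.
Unshelve. all: by end_near. Qed.

Lemma horizon_gt (R : realType) (tau : \bar R) (t : R) :
  (t%:E < tau)%E -> exists r, t < r /\ (r%:E < tau)%E.
Proof.
case: tau => [u||//]; last by exists (t + 1); rewrite ltrDl ltry.
by rewrite lte_fin => tu; exists ((t + u) / 2); rewrite lte_fin !midf_lt.
Qed.

(** The horizon has no isolated point; this is what makes the derivative in
    [solves] unique. *)
Lemma horizon_dnbhs_proper (R : realType) (tau : \bar R) (t : R) :
  horizon tau t -> ProperFilter (within (horizon tau) t^').
Proof.
move=> [t0 ttau]; apply: Build_ProperFilter.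
move=> /nbhs_ballP [e /= e0 He].
have [r [r0 rtau]] := horizon_gt ttau.
pose s := Num.min r (t + e / 2).
have ts : t < s by rewrite lt_min r0 ltrDl divr_gt0.
apply: (He s).
- rewrite -ball_normE/= distrC gtr0_norm ?subr_gt0// ltrBlDl.
  by rewrite gt_min ltrD2l gtr_pMr// invf_lt1// ltr1n orbT.
- by rewrite gt_eqF.
- split; first exact/ltW/(le_lt_trans t0).
  by apply: le_lt_trans rtau; rewrite lee_fin ge_min lexx.
Qed.

(** Two functions that agree on [[0, T[] have the same derivative there,
    relative to the horizon, and the derivative of [L_f^k h] along a solution is
    [L_f^(k+1) h]. Working on the half-open interval, where every point has
    points of the interval to its right, keeps the induction going. *)
Lemma lie_output_eq (R : realType) (n p N : nat)
    (f : 'rV[R]_n -> 'rV[R]_n) (h : 'rV[R]_n -> 'rV[R]_p)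
    (tau : \bar R) (z1 z2 : R -> 'rV[R]_n) (T : R) :
  (forall k x, (k < N)%N -> differentiable (iter k (lie f) h) x) ->
  solves f tau z1 -> solves f tau z2 -> (T%:E < tau)%E ->
  (forall t, 0 <= t < T -> h (z1 t) = h (z2 t)) ->
  forall k t, (k <= N)%N -> 0 <= t < T ->
    iter k (lie f) h (z1 t) = iter k (lie f) h (z2 t).
Proof.
move=> dg sol1 sol2 Ttau heq; elim=> [|k IHk] t kN; first exact: heq.
move=> /andP[t0 tT].
have ht : horizon tau t by split=> //; apply: lt_trans Ttau; rewrite lte_fin.
have PF := horizon_dnbhs_proper ht.
have sub : within (horizon tau) t^' `=>` t^' by exact: cvg_within.
set g := iter k (lie f) h.
have dgk x : differentiable g x by apply: dg.
rewrite !iterS -/g !lieE//.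
have c1 := cvg_chain _ sub (dgk (z1 t)) (sol1 t ht).
have c2 := cvg_chain _ sub (dgk (z2 t)) (sol2 t ht).
apply: (cvg_unique (@norm_hausdorff _ _) (c1 _)).
apply: cvg_trans (c2 _); apply: near_eq_cvg.
rewrite near_withinE; near=> s => -[s0 _].
have sT : 0 <= s < T.
  rewrite s0/=; near: s; apply: nbhs_dnbhs; exact: lt_nbhsl.
by rewrite /g !IHk ?(ltnW kN)// t0.
Unshelve. all: by end_near. Qed.

(** * Local injectivity of C^1 maps with injective differential *)

Lemma Ck_mulmxr (R : realType) (n m q k : nat) (G : 'rV[R]_n -> 'rV[R]_m)
    (B : 'M[R]_(m, q)) :
  Ck k G -> Ck k (fun x => G x *m B).
Proof.
move=> CG; rewrite (_ : (fun x => _) =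
  fun x => \sum_(i < m) G x 0 i *: row i B).
  by apply: Ck_sum => i; apply: Ck_coord.
by apply/funext => x; rewrite mulmx_sum_row.
Qed.

Lemma jacobian_mulmxr (R : realType) (n m q : nat) (G : 'rV[R]_n -> 'rV[R]_m)
    (B : 'M[R]_(m, q)) (x : 'rV[R]_n) :
  differentiable G x -> 'J (fun y => G y *m B) x = 'J G x *m B.
Proof.
move=> dG.
have Bc : continuous (mulmxr B : 'rV[R]_m -> 'rV[R]_q).
  apply: (@Ck_mulmxr _ _ _ _ 0 id) => y; exact: cvg_id.
have dB y : differentiable (mulmxr B : 'rV[R]_m -> 'rV[R]_q) y.
  exact: linear_differentiable.
apply/row_matrixP => i; rewrite row_mul !rowE.
rewrite -!deriveEjacobian//; last exact: (differentiable_comp dG (dB _)).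
rewrite !deriveE//; last exact: (differentiable_comp dG (dB _)).
have -> := diff_comp dG (dB (G x)).
by rewrite /= diff_lin.
Qed.

Lemma row_norm_le (R : realType) (n : nat) (v : 'rV[R]_n) (c : R) :
  0 <= c -> (forall j, `|v 0 j| <= c) -> `|v| <= c.
Proof.
move=> c0 vc; rewrite /Num.norm/= mx_normrE.
by apply: bigmax_le => //= -[i j] _; rewrite (ord1 i).
Qed.

Lemma row_coord_le_norm (R : realType) (n : nat) (v : 'rV[R]_n) (j : 'I_n) :
  `|v 0 j| <= `|v|.
Proof.
rewrite [X in _ <= X]/Num.norm/= mx_normrE.
exact: (@le_bigmax _ _ _ _ (fun ij => `|v ij.1 ij.2|) (0, j)).
Qed.

Lemma rowM_norm_le (R : realType) (n : nat) (v : 'rV[R]_n) (A : 'M[R]_n)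
    (e : R) :
  0 <= e -> (forall i j, `|A i j| <= e) -> `|v *m A| <= n%:R * e * `|v|.
Proof.
move=> e0 Ae; apply: row_norm_le => [|j]; first by rewrite !mulr_ge0.
rewrite mxE; apply: le_trans (ler_norm_sum _ _ _) _.
rewrite -mulrA (_ : n%:R * (e * `|v|) = \sum_(k < n) e * `|v|).
  by rewrite ler_sum// => k _; rewrite normrM mulrC ler_pM// row_coord_le_norm.
by rewrite sumr_const card_ord mulr_natl.
Qed.

(** A vector-valued map with equal values at [x] and [y] need not have a
    critical point in the direction [x - y] between them, but each of its
    coordinates has one. *)
Lemma Rolle_segment (R : realType) (V : normedModType R) (K : V -> R)
    (x y : V) :
  (forall z, differentiable K z) -> K x = K y ->
  exists2 t : R, 0 <= t <= 1 & 'D_(x - y) K (y + t *: (x - y)) = 0.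
Proof.
move=> dK Kxy; pose L (t : R) := y + t *: (x - y).
have dL t : is_diff t L ( *:%R ^~ (x - y)).
  by apply: is_diff_eq; rewrite add0r.
have dc t : differentiable (K \o L) t by apply: differentiable_comp.
have [t _| | |t tI [_ dt]] := @Rolle _ (K \o L) 0 1 ltr01.
- exact: diff_derivable.
- by apply: continuous_subspaceT => t; exact: differentiable_continuous.
- by rewrite /= /L scale0r scale1r addr0 subrKC.
exists t; first by move: tI; rewrite in_itv/= => /andP[/ltW-> /ltW->].
move: dt; rewrite deriveE// diff_comp// /= diff_val scale1r.
by rewrite -deriveE.
Qed.

(** Let [v = x - y] with [K x = K y]. For each coordinate [j], Rolle gives a
    point [z] of the segment with [(v *m 'J K z) 0 j = 0], so that [v 0 j] is
    the [j]-th coordinate of [v *m ('J K a - 'J K z)]. Near [a] the last matrix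
    is so small that [`|v| <= c * `|v|] with [c < 1]. *)
Lemma locally_injective_id (R : realType) (n : nat)
    (K : 'rV[R]_n -> 'rV[R]_n) (a : 'rV[R]_n) :
  Ck 1 K -> 'J K a = 1%:M ->
  exists2 r : R, 0 < r &
    forall x y, ball a r x -> ball a r y -> K x = K y -> x = y.
Proof.
move=> [dK CK] Ja.
have Jc i j : {for a, continuous (fun x => 'J K x i j)}.
  rewrite (_ : (fun x => _) = (fun x => 'D_(delta_mx 0 i) K x 0 j)).
    exact: (@continuous_coord_comp _ _ _ _ j (CK _)).
  apply/funext => x; rewrite deriveEjacobian; last exact: dK.
  by rewrite -rowE [RHS]mxE.
(* With entries of size at most [e], a matrix of size [n] contracts by the
   factor [n * e < 1]. *)
pose e : R := (n.+1%:R)^-1.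
have e0 : 0 < e by rewrite invr_gt0 ltr0n.
have Je : \forall x \near a, forall ij,
    `|'J K a ij.1 ij.2 - 'J K x ij.1 ij.2| <= e.
  apply: (@filter_forall _ _ (fun ij x =>
    `|'J K a ij.1 ij.2 - 'J K x ij.1 ij.2| <= e) (nbhs a) _) => -[i j] /=.
  have /cvgrPdist_le Jij : 'J K x i j @[x --> a] --> 'J K a i j := Jc i j.
  exact: Jij.
have /nbhs_ballP[r /= r0 ball_J] := Je.
exists r => // x y ax ay Kxy; set v := x - y.
have vj j : `|v 0 j| <= n%:R * e * `|v|.
  have [z| |t t01 Dt] := @Rolle_segment _ _ (fun z => K z 0 j) x y.
  - exact: differentiable_coord_comp.
  - by rewrite Kxy.
  set z := y + t *: (x - y) in Dt.
  have az : ball a r z.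
    move: ax ay; rewrite -!ball_normE/= => ax ay.
    (* Balls are convex. *)
    have -> : a - z = t *: (a - x) + (1 - t) *: (a - y).
      by apply/rowP => k; rewrite !mxE; ring.
    have /andP[t0 t1] := t01.
    apply: (le_lt_trans (ler_normD _ _)).
    rewrite !normrZ (ger0_norm t0) ger0_norm ?subr_ge0//.
    have [->|tn0] := eqVneq t 0; first by rewrite mul0r add0r subr0 mul1r.
    have -> : r = t * r + (1 - t) * r by rewrite -mulrDl subrKC mul1r.
    apply: ltr_leD; first by rewrite ltr_pM2l// lt_neqAle eq_sym tn0.
    by rewrite ler_wpM2l ?subr_ge0// ltW.
  rewrite derive_coord// deriveEjacobian// -/v in Dt.
  have -> : v 0 j = (v *m ('J K a - 'J K z)) 0 j.
    by rewrite mulmxBr Ja mulmx1 [RHS]mxE [X in _ + X]mxE Dt oppr0 addr0.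
  apply: le_trans (@rowM_norm_le _ _ v ('J K a - 'J K z) e (ltW e0) _).
    exact: row_coord_le_norm.
  move=> i k; have /= := ball_J z az (i, k).
  by rewrite [X in _ -> `|X| <= _]mxE [X in _ -> `|_ + X| <= _]mxE.
have vle : `|v| <= n%:R * e * `|v|.
  apply: row_norm_le => //.
  by rewrite !mulr_ge0// ltW.
have v0 : `|v| <= 0.
  have : `|v| * (1 - n%:R * e) <= 0 by rewrite mulrBr mulr1 subr_le0 mulrC.
  by rewrite pmulr_lle0// subr_gt0 ltr_pdivrMr ?mul1r ?ltr_nat// ltr0n.
by apply/eqP; rewrite -subr_eq0 -normr_le0.
Qed.

(** A matrix [B] with ['J G a *m B = 1] exists since the rows of ['J G a] are
    free; [G] followed by [B] has the identity as Jacobian at [a], and where it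
    is injective so is [G]. *)
Lemma locally_injective (R : realType) (n m : nat)
    (G : 'rV[R]_n -> 'rV[R]_m) (a : 'rV[R]_n) :
  Ck 1 G -> \rank ('J G a) = n ->
  exists2 r : R, 0 < r &
    forall x y, ball a r x -> ball a r y -> G x = G y -> x = y.
Proof.
move=> CG rkJ.
have /row_freeP[B JB] : row_free ('J G a) by rewrite /row_free rkJ.
have [|r r0 inj] :=
  @locally_injective_id _ _ (fun x => G x *m B) a (Ck_mulmxr B CG).
  by rewrite jacobian_mulmxr//; apply CG.
by exists r => // x y ax ay Gxy; apply: inj => //; rewrite Gxy.
Qed.

(** * The observability time *)

Lemma obs_map_eq (R : realType) (n p N : nat)
    (f : 'rV[R]_n -> 'rV[R]_n) (h : 'rV[R]_n -> 'rV[R]_p) (x y : 'rV[R]_n) :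
  (forall k, (k < N)%N -> iter k (lie f) h x = iter k (lie f) h y) ->
  obs_map f h N x = obs_map f h N y.
Proof.
move=> lexy; rewrite /obs_map; congr mxvec.
by apply/matrixP => k j; rewrite !mxE lexy.
Qed.

Lemma within_separated (R : realType) (n p : nat) (Omega : set 'rV[R]_n)
    (u : 'rV[R]_n -> 'rV[R]_p) (a b : 'rV[R]_n) :
  {within Omega, continuous u} -> Omega a -> Omega b -> u a <> u b ->
  \forall x \near a & y \near b, Omega x -> Omega y -> u x <> u y.
Proof.
move=> /subspace_continuousP uc Oa Ob uab.
have := @norm_hausdorff R 'rV[R]_p; rewrite open_hausdorff => sep.
have [[U V] /= [/set_mem aU /set_mem bV] [oU oV /eqP UV0]] :=
  sep _ _ (introN eqP uab).
exists ((fun x => Omega x -> U (u x)), (fun y => Omega y -> V (u y))).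
  split.
    exact: (uc a Oa) _ (open_nbhs_nbhs (conj oU aU)).
  exact: (uc b Ob) _ (open_nbhs_nbhs (conj oV bV)).
move=> [x y] /= [xU yV] Ox Oy uxy.
suff : (U `&` V) (u x) by rewrite UV0.
by split; [exact: xU|rewrite uxy; exact: yV].
Qed.

Theorem proposition7 (R : realType) (n p : nat)
    (f : 'rV[R]_n -> 'rV[R]_n) (h : 'rV[R]_n -> 'rV[R]_p)
    (Omega : set 'rV[R]_n) (tau : \bar R)
    (phi : R -> 'rV[R]_n -> 'rV[R]_n)
    (f_cont : continuous f) (h_cont : continuous h)
    (Omega_compact : compact Omega)
    (tau_gt0 : (0 < tau)%E)
    (phi_sol : solution_map f Omega tau phi)
    (phi_cont : forall t : R, horizon tau t ->
       {within Omega, continuous (phi t)})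
    (D_obs : D_observable h Omega tau phi)
    (R_obs : R_observable f h Omega) :
  exists T : R, [/\ 0 < T, (T%:E < tau)%E &
    forall x1 x2 : 'rV[R]_n, Omega x1 -> Omega x2 -> x1 <> x2 ->
      exists t : R, 0 <= t <= T /\ h (phi t x1) <> h (phi t x2)].
Proof.
have [N [N0 CNh CNf rankH]] := R_obs.
pose D : set R := [set T | 0 < T /\ (T%:E < tau)%E].
pose A (T : R) : set ('rV[R]_n * 'rV[R]_n) := [set xy |
  [/\ Omega xy.1, Omega xy.2, xy.1 <> xy.2 &
      forall t, 0 <= t <= T -> h (phi t xy.1) = h (phi t xy.2)]].
have above t : horizon tau t -> exists2 T, D T & t <= T.
  move=> [t0 ttau]; have [r [tr rtau]] := horizon_gt ttau.
  by exists r; [split=> //; apply: le_lt_trans tr|exact: ltW].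
apply: contrapT => noT.
have A_neq0 T : D T -> A T !=set0.
  move=> [T0 Ttau]; apply: contrapT => A0; apply: noT.
  exists T; split=> // x y Ox Oy xy.
  apply: contrapT => allt; apply: A0; exists (x, y); split=> // t t0T.
  by apply: contrapT => ht; apply: allt; exists t.
have A_le S T : S <= T -> A T `<=` A S.
  move=> ST [x y] [Ox Oy xy hxy]; split=> // t /andP[t0 tS].
  by apply: hxy; rewrite t0 (le_trans tS).
pose F := filter_from D A.
have FF : ProperFilter F.
  apply: filter_from_proper A_neq0; apply: filter_from_filter.
    by have [|T DT _] := above 0; [split|exists T].
  move=> S T [S0 Stau] [T0 Ttau]; exists (Num.max S T).
    by split; [rewrite lt_max S0|case: (leP S T)].
  by move=> xy Axy; split; apply: A_le Axy; rewrite le_max lexx ?orbT.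
have FO : F (Omega `*` Omega).
  have [|T DT _] := above 0; first by split.
  by exists T => // xy [].
have [[a b] [[/= Oa Ob] ab]] := compact_setX Omega_compact Omega_compact FF FO.
have meet T U : D T -> nbhs (a, b) U -> exists x y, A T (x, y) /\ U (x, y).
  move=> DT nU; have [||[x y] [Axy Uxy]] := ab (A T) U; last by exists x, y.
    by exists T.
  by [].
have [eab|neab] := eqVneq a b; last first.
  have [t ht hab] : exists2 t, horizon tau t & h (phi t a) <> h (phi t b).
    apply: contrapT => allt; apply: D_obs; exists a, b; split=> //.
    split=> [|t ht]; first exact/eqP.
    by apply: contrapT => hn; apply: allt; exists t.
  have [T DT tT] := above t ht.
  have hphi_cont : {within Omega, continuous (h \o phi t)}.
    move=> x; exact: (continuous_comp (phi_cont t ht x) (h_cont _)).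
  have [x [y [[/= Ox Oy _ hxy] Uxy]]] :=
    meet T _ DT (within_separated hphi_cont Oa Ob hab).
  by apply: Uxy => //=; apply: hxy; case: ht => ->.
have CH := Ck_obs_map CNf CNh.
have [r r0 inj] := locally_injective CH (rankH a Oa).
have [T DT _] := above 0 (conj (lexx 0) tau_gt0).
have nU : nbhs (a, b) (ball a r `*` ball a r).
  exists (ball a r, ball a r) => //=; rewrite -eab; split; exact: nbhsx_ballx.
have [x [y [[/= Ox Oy xy hxy] [/= ax ay]]]] := meet T _ DT nU.
apply: xy; apply: inj ax ay _; apply: obs_map_eq => k kN.
have [phi0x solx _] := phi_sol x Ox; have [phi0y soly _] := phi_sol y Oy.
have [T0 Ttau] := DT.
rewrite -phi0x -phi0y.
apply: (lie_output_eq _ solx soly Ttau _ (ltnW kN)); last by rewrite lexx.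
- move=> l z lN; have : Ck 1 (iter l (lie f) h).
    apply: (@Ck_le _ _ _ 1 (N - l)%N); first by rewrite subn_gt0.
    exact: Ck_iter_lie.
  by case.
- by move=> t /andP[t0 tT]; apply: hxy; rewrite t0 ltW.
Qed.
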